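(* Let $X,Y,Z$ be real normed vector spaces, $K\subset Y$ a proper convex cone with $\operatorname{int}K\neq\emptyset$, $Q\subset Z$ a closed convex pointed cone, $L\subset S_X$ a nonempty closed set, and $f:X\to Y$, $g:X\to Z$ continuously Fréchet differentiable functions. Let $\mathcal{E}_g:X\rightrightarrows Z$, $\mathcal{E}_g(x)=g(x)+Q$, and $A:=\mathcal{E}_g^{-1}(0)=\{x\in X\mid 0\in g(x)+Q\}$. Suppose that $\overline{x}\in A$ is a local weak directional Pareto minimum point for $f$ on $A$ with respect to $L$. Moreover, suppose that $\operatorname{cone}L$ is convex and that $\mathcal{E}_g$ is directionally metric subregular at $(\overline{x},0)$ with respect to $L$ and $S_Z$. Then, under either of the following conditions: (i) $\operatorname{int}Q\neq\emptyset$ or $\operatorname{int}\{(\nabla f(\overline{x})(u),\nabla g(\overline{x})(u))\mid u\in\operatorname{cone}L\}\neq\emptyset$; (ii) $Y$ and $Z$ are finite dimensional spaces, there exist $y^*\in K^+$, $z^*\in Q^+$, $(y^*,z^* )\neq0$, such that for every $u\in\operatorname{cone}L$, $$\bigl(y^*\circ\nabla f(\overline{x})+z^*\circ\nabla g(\overline{x})\bigr)(u)\ge0 .$$ If, moreover, either $\operatorname{int}Q\neq\emptyset$ and there exists $u\in\operatorname{cone}L$ such that $\nabla g(\overline{x})(u)\in-\operatorname{int}Q$, or $\nabla g(\overline{x})(\operatorname{cone}L)=Z$, then $y^*\neq0$.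
   Context: $S_X,S_Z$ are the unit spheres; $\operatorname{cone}C=\{tc\mid t\ge0,\ c\in C\}$. A convex cone $K$ is proper if $K\neq\{0\}$ and $K\neq Y$ (not necessarily pointed); $Q$ pointed means $Q\cap(-Q)=\{0\}$. $K^+=\{y^*\in Y^*\mid y^*(y)\ge0\ \forall y\in K\}$, and similarly $Q^+\subset Z^*$, where stars denote topological duals. $\nabla f(\overline{x})$ is the Fréchet derivative. Local weak directional Pareto minimum: $\overline{x}\in A$ is a local weak directional Pareto minimum point for $f$ on $A$ with respect to $L$ if there is a neighborhood $U$ of $\overline{x}$ such that $f(x)-f(\overline{x})\notin-\operatorname{int}K$ for all $x\in U\cap A\cap(\overline{x}+\operatorname{cone}L)$. Directional minimal time function: for $\emptyset\neq L\subset S_X$, $T_L(x,\Omega)=\inf\{t\ge0\mid \exists u\in L:\ x+tu\in\Omega\}$, with $\inf\emptyset=+\infty$; similarly in $Z$ (in particular $T_{S_Z}(z,\Omega)$ is the distance from $z$ to $\Omega$, equal to $+\infty$ if $\Omega=\emptyset$). Directional metric subregularity: $\mathcal{E}_g$ is directionally metric subregular at $(\overline{x},0)$ with respect to $L$ and $S_Z$ if there are $\alpha>0$ and neighborhoods $U$ of $\overline{x}$, $V$ of $0$ such that for every $x\in U$, $T_L(x,\mathcal{E}_g^{-1}(0))\le\alpha T_{S_Z}(0,\mathcal{E}_g(x)\cap V)$. *)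

(* Defs.v *)
From HB Require Import structures.
From mathcomp Require Import all_boot all_order all_algebra.
From mathcomp Require Import all_classical all_reals all_analysis.

Set Implicit Arguments.
Unset Strict Implicit.
Unset Printing Implicit Defensive.

Import Order.TTheory GRing.Theory Num.Theory.
Import numFieldNormedType.Exports.

Local Open Scope classical_set_scope.
Local Open Scope ring_scope.

Definition unit_sphere (R : realType) (V : normedModType R) : set V :=
  [set v | `|v| = 1].
Arguments unit_sphere {R} V.

Definition set_opp (R : realType) (V : normedModType R) (A : set V) : set V :=
  -%R @` A.

Definition cone (R : realType) (V : lmodType R) (C : set V) : set V :=
  [set v | exists t : R, exists c : V, [/\ 0 <= t, C c & v = t *: c]].

(* With cone C = {tc | t >= 0, c in C}, a set is a cone when it contains the
   cone it generates. *)
Definition convex_cone (R : realType) (V : lmodType R) (C : set V) : Prop :=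
  cone C `<=` C /\ convex_set C.

Definition proper_cone (R : realType) (V : lmodType R) (C : set V) : Prop :=
  C <> [set 0] /\ C <> setT.

Definition pointed (R : realType) (V : normedModType R) (C : set V) : Prop :=
  C `&` set_opp C = [set 0].

(* The codomain is R^o, the field R seen as a normed module over itself; the
   continuity requirement makes the elements of the set members of the
   topological dual. *)
Definition dual_cone (R : realType) (V : normedModType R) (C : set V) :
    set {linear V -> R^o} :=
  [set phi | continuous (phi : V -> R^o) /\ forall v, C v -> 0 <= (phi v : R)].

Definition finite_dimensional (R : realType) (V : lmodType R) : Prop :=
  exists (n : nat) (b : 'I_n -> V),
    forall v : V, exists c : 'I_n -> R, v = \sum_(i < n) c i *: b i.

Definition op_norm (R : realType) (V W : normedModType R) (h : V -> W) :
    \bar R :=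
  ereal_sup [set `|h v|%:E | v in [set v : V | `|v| <= 1]].

(* The derivative ['d f] is continuous from V to the space of bounded linear
   maps with the operator norm. *)
Definition continuously_differentiable (R : realType) (V W : normedModType R)
    (f : V -> W) : Prop :=
  (forall x : V, differentiable f x) /\
  forall x : V,
    op_norm (fun v => 'd f y v - 'd f x v) @[y --> x] --> (0%:E : \bar R).

(* The infimum is taken in the extended reals, hence it is +oo when no point of
   Omega is reached. *)
Definition minimal_time (R : realType) (V : normedModType R) (L : set V)
    (x : V) (Omega : set V) : \bar R :=
  ereal_inf [set t%:E | t in
    [set t : R | 0 <= t /\ exists2 u, L u & Omega (x + t *: u)]].

Definition set_valued_inv (X Z : Type) (F : X -> set Z) (z : Z) : set X :=
  [set x | F x z].

Definition epi_map (R : realType) (X Z : normedModType R) (g : X -> Z)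
    (Q : set Z) : X -> set Z :=
  fun x => [set g x + q | q in Q].

Definition dir_metric_subregular (R : realType) (X Z : normedModType R)
    (F : X -> set Z) (xbar : X) (zbar : Z) (L : set X) (M : set Z) : Prop :=
  exists (alpha : R) (U : set X) (V : set Z),
    [/\ 0 < alpha, nbhs xbar U, nbhs zbar V &
     forall x, U x ->
       (minimal_time L x (set_valued_inv F zbar)
          <= alpha%:E * minimal_time M zbar (F x `&` V))%E].

Definition local_weak_dir_pareto_min (R : realType) (X Y : normedModType R)
    (f : X -> Y) (K : set Y) (A : set X) (L : set X) (xbar : X) : Prop :=
  A xbar /\
  exists2 U : set X, nbhs xbar U &
    forall x, (U `&` A `&` [set xbar + v | v in cone L]) x ->
      ~ set_opp (interior K) (f x - f xbar).

(* Main.v *)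
Require Import Defs.
From HB Require Import structures.
From mathcomp Require Import all_boot all_order all_algebra.
From mathcomp Require Import all_classical all_reals all_analysis.
From mathcomp Require Import ring lra.

Set Implicit Arguments.
Unset Strict Implicit.
Unset Printing Implicit Defensive.

Import Order.TTheory GRing.Theory Num.Theory.
Import numFieldNormedType.Exports.

Local Open Scope classical_set_scope.
Local Open Scope ring_scope.

(* Subregularity rules out any u in cone L with f'(xbar) u in -int K and
   g'(xbar) u in -Q: a step t u is infeasible only by o(t), a further step of
   length o(t) along L reaches A, and f would still strictly decrease there.
   Hence the convex cone
     {(f'(xbar) u + k, g'(xbar) u + q) | u in cone L, k in int K, q in Q}
   omits 0, and the multipliers come from separating it from 0.  For the
   separation, Zorn's lemma enlarges the cone to a convex cone C omitting 0
   such that every nonzero v has v or -v in C; if b is an algebraic interior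
   point of C, then v |-> sup {t | v - t b in C} is linear, and nonnegative
   on C.  In finite dimension such a b always exists, since up to sign every vector of a
   spanning family is 0 or lies in C. *)

(** * Separation of convex cones from the origin *)

(** Serves to pass from [interior K] to [K]: an inequality known at k + t k0 for k0 interior and
    every t > 0 survives as t tends to 0. *)
Lemma ge0_of_perturbation (R : realFieldType) (a b : R) :
  (forall t, 0 < t -> 0 <= a + t * b) -> 0 <= a.
Proof.
move=> ab; rewrite leNgt; apply/negP => a0.
have [b0|b0] := leP b 0; first by have := ab 1 ltr01; lra.
have t0 : 0 < - a / (2 * b) by rewrite divr_gt0 ?mulr_gt0//; lra.
have := ab _ t0.
have -> : - a / (2 * b) * b = - a / 2 by field; lra.
lra.
Qed.

Lemma linear_of_fun (R : nzRingType) (V W : lmodType R) (h : V -> W) :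
  linear h -> exists phi : {linear V -> W}, forall v, phi v = h v.
Proof.
move=> h_lin.
pose H := GRing.isLinear.Build R V W *:%R h h_lin.
pose phi : {linear V -> W} := HB.pack h H.
by exists phi.
Qed.

Section blunt_cones.
Variables (R : realType) (V : lmodType R).
Implicit Types (B C : set V) (v b : V).

Definition blunt_cone C := [/\ forall x y, C x -> C y -> C (x + y),
  forall t x, 0 < t -> C x -> C (t *: x) & ~ C 0].

Definition total_cone C := forall v, [\/ v = 0, C v | C (- v)].

(** Algebraic interior; for a convex set containing b, one step e in each direction already yields a
    segment. *)
Definition core_point B b := forall v, exists2 e : R, 0 < e & B (b + e *: v).

Lemma blunt_cone_extension B : blunt_cone B ->
  exists C, [/\ B `<=` C, blunt_cone C & total_cone C].
Proof.
move=> [Badd Bscale B0].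
(* Zorn is applied to the sets A whose union with B is a blunt cone, so that the empty chain yields
   B itself. *)
have chain_sup (F : set (set V)) : F `<=` [set A | blunt_cone (A `|` B)] ->
    total_on F subset -> blunt_cone (\bigcup_(A in F) A `|` B).
  move=> FP Ftot; split.
  - have up A x : F A -> (A `|` B) x -> (\bigcup_(A in F) A `|` B) x.
      by move=> FA [Ax|Bx]; [left; exists A|right].
    move=> x y [[A FA Ax]|Bx] [[A' FA' A'y]|By].
    + have [AA'|A'A] := Ftot _ _ FA FA'.
        apply: (up _ _ FA'); have [add _ _] := FP _ FA'.
        by apply: add; left=> //; exact: AA'.
      apply: (up _ _ FA); have [add _ _] := FP _ FA.
      by apply: add; left=> //; exact: A'A.
    + apply: (up _ _ FA); have [add _ _] := FP _ FA.
      by apply: add; [left|right].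
    + apply: (up _ _ FA'); have [add _ _] := FP _ FA'.
      by apply: add; [right|left].
    + by right; exact: Badd.
  - move=> t x t0 [[A FA Ax]|Bx]; last by right; exact: Bscale.
    have [_ scale _] := FP _ FA.
    by have [Atx|Btx] := scale t x t0 (or_introl Ax); [left; exists A|right].
  - by move=> [[A FA A0]|//]; have [_ _] := FP _ FA; apply; left.
have [A [[Cadd Cscale C0] Amax]] := Zorn_bigcup chain_sup.
exists (A `|` B); split => // v.
have [->|v0] := pselect (v = 0); first by constructor 1.
have [Cv|NCv] := pselect ((A `|` B) v); first by constructor 2.
have [CNv|NCNv] := pselect ((A `|` B) (- v)); first by constructor 3.
(* The cone generated by v and the maximal cone; the side conditions exclude only t = 0 together
   with c = 0. *)
pose D := [set w | exists t c, [/\ 0 <= t, c = 0 \/ (A `|` B) c,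
  (0 < t \/ (A `|` B) c) & w = c + t *: v]].
have CD : A `|` B `<=` D.
  by move=> c Cc; exists 0, c; split; [|right|right|rewrite scale0r addr0].
have Dv : D v by exists 1, 0; split; [|left|left|rewrite scale1r add0r].
have AD : A `<` D.
  split; first by move=> a Aa; apply: CD; left.
  by move=> /(_ v Dv) Av; apply: NCv; left.
have DB : D `|` B = D by apply/setUidl => w Bw; apply: CD; right.
exfalso; apply: (Amax _ AD) => /=; rewrite DB; split.
- move=> _ _ [t [c [t0 cC tc ->]]] [t' [c' [t'0 c'C tc' ->]]].
  exists (t + t'), (c + c'); split.
  + exact: addr_ge0.
  + case: cC => [->|Cc]; first by rewrite add0r.
    by right; case: c'C => [->|Cc']; [rewrite addr0|exact: Cadd].
  + case: tc => [tp|Cc]; first by left; exact: ltr_wpDr.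
    by right; case: c'C => [->|Cc']; [rewrite addr0|exact: Cadd].
  + by rewrite scalerDl addrACA.
- move=> s _ s0 [t [c [t0 cC tc ->]]]; exists (s * t), (s *: c); split.
  + by rewrite mulr_ge0// ltW.
  + by case: cC => [->|Cc]; [left; rewrite scaler0|right; exact: Cscale].
  + by case: tc => [tp|Cc]; [left; exact: mulr_gt0|right; exact: Cscale].
  + by rewrite scalerDr scalerA.
(* If c + t v = 0, then t = 0 would put 0 in the cone, c = 0 would give v = 0, and otherwise - v = c
   / t lies in the cone. *)
- move=> [t [c [t0 cC tc /esym/eqP]]]; rewrite addr_eq0 => /eqP cE.
  move: t0; rewrite le_eqVlt => /predU1P[t0|t0].
    move: tc; rewrite cE -t0 scale0r oppr0 ltxx; by case.
  case: cC => [c0|Cc].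
    move: cE; rewrite c0 => /esym/eqP; rewrite oppr_eq0 scaler_eq0 gt_eqF//=.
    by move/eqP.
  apply: NCNv; have := Cscale t^-1 c; rewrite invr_gt0 => /(_ t0 Cc).
  by rewrite cE scalerN scalerA mulVf ?scale1r ?gt_eqF.
Qed.

(** Each [S v] is downward closed and bounded above, with supremum [h v]. Sums in C make h
    superadditive and totality makes it odd; together these give additivity, and the scaling
    inequality becomes an equality in the same way. *)
Lemma total_cone_functional C b : blunt_cone C -> total_cone C -> C b ->
  core_point C b ->
  exists phi : {linear V -> R^o},
    phi b = 1 /\ forall v, C v -> 0 <= (phi v : R).
Proof.
move=> [Cadd Cscale C0] Ctot Cb core.
pose S v := [set t : R | C (v - t *: b)].
have S_lt v s t : S v t -> ~ S v s -> t < s.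
  move=> St NSs; rewrite ltNge; apply/negP => st; apply: NSs.
  move: st; rewrite le_eqVlt => /predU1P[->//|st].
  have := Cadd _ _ St (Cscale (t - s) b _ Cb); rewrite subr_gt0 => /(_ st).
  by rewrite /S/= scalerBl addrA subrK.
have S_bounded v s t : S v t -> S (- v) s -> t + s < 0.
  move=> St Ss; have := Cadd _ _ St Ss.
  rewrite addrACA subrr add0r -opprD -scalerDl => Cts.
  have [//|p|ts0] := ltgtP (t + s) 0; last first.
    by move: Cts; rewrite ts0 scale0r oppr0.
  by have := Cadd _ _ Cts (Cscale _ _ p Cb); rewrite addNr.
(* Dividing b + e v by e shows that v + b / e is in C. *)
have S0 v : S v !=set0.
  have [e e0 Ce] := core v; exists (- e^-1); rewrite /S/= scaleNr opprK.
  have := Cscale e^-1 _ _ Ce; rewrite invr_gt0 => /(_ e0).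
  by rewrite scalerDr scalerA mulVf ?gt_eqF// scale1r addrC.
have supS v : has_sup (S v).
  split => //; have [s Ss] := S0 (- v).
  by exists (- s) => t St; have := S_bounded _ _ _ St Ss; lra.
pose h v : R^o := sup (S v).
have h_ge v t : S v t -> t <= h v by apply: sup_upper_bound.
have h_lt v t : t < h v -> S v t.
  move=> th; apply: contrapT => NSt.
  have : h v <= t by apply: sup_le_ub => // s /S_lt /(_ NSt) /ltW.
  by rewrite leNgt th.
have hN v : h (- v) = - h v.
  apply/eqP; rewrite eq_le; apply/andP; split.
    apply: sup_le_ub => // s Ss; rewrite lerNr; apply: sup_le_ub => // t St.
    by have := S_bounded _ _ _ St Ss; lra.
  rewrite leNgt; apply/negP => lt_h.
  (* For m strictly between [h (- v)] and [- h v], neither v + m b nor its opposite is in C, so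
     totality leaves v + m b = 0. This cannot happen for two values of m, hence the points at one
     third and two thirds of the gap. *)
  have gap m : h (- v) < m -> m < - h v -> ~ S (- v) m /\ ~ S v (- m).
    by move=> m1 m2; split=> /h_ge; lra.
  pose d := - h v - h (- v).
  have [NS1 NS2] : ~ S (- v) (h (- v) + d / 3) /\ ~ S v (- (h (- v) + d / 3)).
    by apply: gap; rewrite /d; lra.
  have [NS3 NS4] : ~ S (- v) (- h v - d / 3) /\ ~ S v (- (- h v - d / 3)).
    by apply: gap; rewrite /d; lra.
  have [vE|C1|C1] := Ctot (v + (h (- v) + d / 3) *: b).
  - apply: NS4; rewrite /S/= scaleNr opprK.
    have -> : v + (- h v - d / 3) *: b = (d / 3) *: b.
      rewrite -[LHS]subr0 -vE opprD addrACA subrr add0r -scalerBl.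
      by congr (_ *: _); rewrite /d; field.
    by apply: Cscale => //; rewrite /d; lra.
  - by apply: NS2; rewrite /S/= scaleNr opprK.
  - by apply: NS1; rewrite /S/= -opprD.
have hD_ge v w : h v + h w <= h (v + w).
  rewrite -lerBrDr; apply: sup_le_ub => // s Ss; rewrite lerBrDr addrC -lerBrDr.
  apply: sup_le_ub => // t St; rewrite lerBrDr [t + s]addrC; apply: h_ge.
  by have := Cadd _ _ Ss St; rewrite /S/= addrACA -opprD -scalerDl.
have hD v w : h (v + w) = h v + h w.
  apply/eqP; rewrite eq_le hD_ge andbT.
  by have := hD_ge (- v) (- w); rewrite -opprD !hN; lra.
have h0 : h 0 = 0 by have := hD 0 0; rewrite addr0; lra.
have hZp_ge t v : 0 < t -> t * h v <= h (t *: v).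
  move=> t0; rewrite mulrC -ler_pdivlMr//; apply: sup_le_ub => // s Ss.
  rewrite ler_pdivlMr// mulrC; apply: h_ge.
  by have := Cscale _ _ t0 Ss; rewrite /S/= scalerBr scalerA.
have hZp t v : 0 < t -> h (t *: v) = t * h v.
  move=> t0; apply/eqP; rewrite eq_le hZp_ge// andbT.
  by have := hZp_ge t (- v) t0; rewrite scalerN !hN; lra.
have hZ t v : h (t *: v) = t * h v.
  have [t0|t0|->] := ltgtP t 0; last by rewrite scale0r mul0r.
    by rewrite -[t]opprK scaleNr hN hZp ?mulNr// oppr_gt0.
  exact: hZp.
have h_lin : linear h by move=> t v w; rewrite hD hZ.
have [phi phiE] := linear_of_fun h_lin.
exists phi; split; last first.
  by move=> v Cv; rewrite phiE; apply: h_ge; rewrite /S/= scale0r subr0.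
(* b - t b is in C for t < 1, while for t > 1 adding (t - 1) b to it would put 0 in C. *)
rewrite phiE; apply/eqP; rewrite eq_le; apply/andP; split.
  apply: sup_le_ub => // s Ss; rewrite leNgt; apply/negP => s1.
  have := Cadd _ _ Ss (Cscale (s - 1) b _ Cb); rewrite subr_gt0 => /(_ s1).
  by rewrite scalerBl scale1r addrA addrNK subrr.
rewrite leNgt; apply/negP => h1.
pose m := (1 + h b) / 2.
have : m <= h b; last by rewrite /m; lra.
apply: h_ge; rewrite /S/= -{1}[b]scale1r -scalerBl; apply: Cscale => //.
by rewrite /m; lra.
Qed.

End blunt_cones.

Lemma total_cone_core (R : realType) (V : lmodType R) (C : set V) :
  finite_dimensional V -> blunt_cone C -> total_cone C -> C !=set0 ->
  exists2 b, C b & core_point C b.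
Proof.
move=> [n [b b_span]] [Cadd Cscale C0] Ctot [c0 Cc0].
have /choice[s sP] i : exists s : R, `|s| = 1 /\ (s *: b i = 0 \/ C (s *: b i)).
  have [->|Cb|CNb] := Ctot (b i).
  - by exists 1; rewrite normr1 scaler0; split=> //; left.
  - by exists 1; rewrite normr1 scale1r; split=> //; right.
  - by exists (-1); rewrite normrN normr1 scaleN1r; split=> //; right.
have Csum (a : 'I_n -> R) : (forall i, 0 < a i) ->
    C (c0 + \sum_(i < n) a i *: (s i *: b i)).
  move=> a0.
  have [->|Cs] : \sum_(i < n) a i *: (s i *: b i) = 0 \/
      C (\sum_(i < n) a i *: (s i *: b i)); last exact: Cadd.
    apply: (big_ind (fun x => x = 0 \/ C x)); first by left.
      move=> x y [->|Cx] [->|Cy]; rewrite ?addr0 ?add0r; [by left| by right..|].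
      by right; apply: Cadd.
    move=> i _; have [_ [->|Csb]] := sP i; first by left; rewrite scaler0.
    by right; exact: Cscale.
  by rewrite addr0.
(* The term c0 keeps the point in C even when every signed spanning vector is 0. *)
exists (c0 + \sum_(i < n) 1 *: (s i *: b i)); first by apply: Csum.
move=> v; have [c ->] := b_span v.
set S := \sum_(i < n) `|c i|.
have S0 : 0 <= S by apply: sumr_ge0.
(* Since s i squares to 1, c i b i = (s i c i) (s i b i); this step is short enough that every
   coefficient 1 + s i c i / (1 + S) stays positive. *)
exists (1 + S)^-1; first by rewrite invr_gt0; lra.
rewrite scaler_sumr -addrA -big_split/=.
rewrite (eq_bigr (fun i => (1 + (1 + S)^-1 * (s i * c i)) *: (s i *: b i))).
  apply: Csum => i; have [si _] := sP i.
  have : `|(1 + S)^-1 * (s i * c i)| < 1.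
    rewrite !normrM si mul1r normfV (@ger0_norm _ (1 + S)); last lra.
    rewrite mulrC ltr_pdivrMr ?mul1r; last lra.
    by rewrite /S (bigD1 i)//= addrCA ltrDl ltr_pwDl// sumr_ge0.
  by rewrite ltr_norml; lra.
move=> i _; rewrite [RHS]scalerDl; congr (_ + _).
have [si _] := sP i; rewrite !scalerA; congr (_ *: _).
have s2 : s i * s i = 1 by rewrite -expr2 -real_normK ?num_real// si expr1n.
by rewrite -mulrA; congr (_ * _); rewrite mulrAC s2 mul1r.
Qed.

Lemma cone_separation_core (R : realType) (V : lmodType R) (B : set V) b :
  blunt_cone B -> B b -> core_point B b ->
  exists2 phi : {linear V -> R^o},
    phi b = 1 & forall v, B v -> 0 <= (phi v : R).
Proof.
move=> /blunt_cone_extension[C [BC C_blunt C_total]] Bb b_core.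
have [|phi [phi1 phi_ge0]] := total_cone_functional C_blunt C_total (BC _ Bb).
  by move=> v; have [e e0 Be] := b_core v; exists e => //; exact: BC.
by exists phi => // v /BC /phi_ge0.
Qed.

Lemma cone_separation_findim (R : realType) (V : lmodType R) (B : set V) :
  finite_dimensional V -> blunt_cone B -> B !=set0 ->
  exists phi : {linear V -> R^o},
    (exists b, phi b = 1) /\ forall v, B v -> 0 <= (phi v : R).
Proof.
move=> Vfin /blunt_cone_extension[C [BC C_blunt C_total]] [b0 Bb0].
have [|b Cb b_core] := total_cone_core Vfin C_blunt C_total.
  by exists b0; exact: BC.
have [phi [phi1 phi_ge0]] := total_cone_functional C_blunt C_total Cb b_core.
by exists phi; split=> [|v /BC /phi_ge0//]; exists b.
Qed.

(** * Finite-dimensional spaces: products, bases and continuity of linear functionals *)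

Lemma finite_dimensional_prod (R : realType) (V W : lmodType R) :
  finite_dimensional V -> finite_dimensional W ->
  finite_dimensional (V * W)%type.
Proof.
move=> [n [b b_span]] [m [d d_span]].
exists (n + m)%N, (fun k => match fintype.split k with
  | inl i => (b i, 0) | inr j => (0, d j) end) => -[v w].
have [c ->] := b_span v; have [e ->] := d_span w.
exists (fun k => match fintype.split k with inl i => c i | inr j => e j end).
have fst_sum k (F : 'I_k -> V) : (\sum_i F i, 0 : W) = \sum_i (F i, 0).
  by elim/big_rec2: _ => // i x y _ <-; congr pair; rewrite /= addr0.
have snd_sum k (F : 'I_k -> W) : (0 : V, \sum_i F i) = \sum_i (0, F i).
  by elim/big_rec2: _ => // i x y _ <-; congr pair; rewrite /= addr0.
transitivity
  ((\sum_(i < n) c i *: b i, 0 : W) + (0 : V, \sum_(i < m) e i *: d i)).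
  by congr pair; rewrite /= ?addr0 ?add0r.
rewrite fst_sum snd_sum big_split_ord; congr (_ + _); apply: eq_bigr => i _.
  rewrite -[lshift _ i]/(unsplit (inl i)) unsplitK.
  by congr pair; rewrite /= scaler0.
rewrite -[rshift _ i]/(unsplit (inr i)) unsplitK.
by congr pair; rewrite /= scaler0.
Qed.

(** Induction on the length of a spanning family: a nontrivial relation expresses one vector through
    the others, and that vector is dropped. *)
Lemma finite_dimensional_basis (R : realType) (V : lmodType R) :
  finite_dimensional V -> exists (n : nat) (b : 'I_n -> V),
    (forall v, exists c : 'I_n -> R, v = \sum_(i < n) c i *: b i) /\
    (forall c : 'I_n -> R, \sum_(i < n) c i *: b i = 0 -> forall i, c i = 0).
Proof.
move=> [n [b b_span]]; elim: n => [|n IH] in b b_span *.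
  by exists 0%N, b; split=> // c _ [].
have [b_free|] := pselect (forall c : 'I_n.+1 -> R,
    \sum_(i < n.+1) c i *: b i = 0 -> forall i, c i = 0).
  by exists n.+1, b.
move=> /existsNP[c /not_implyP[c_rel /existsNP[k /eqP ck]]].
apply: (IH (fun j => b (lift k j))) => v.
have bkE : b k = - \sum_(j < n) (c (lift k j) / c k) *: b (lift k j).
  move: c_rel; rewrite (bigD1_ord k)//= => /eqP; rewrite addr_eq0 => /eqP bk.
  apply: (scalerI ck); rewrite bk scalerN scaler_sumr; congr (- _).
  by apply: eq_bigr => j _; rewrite scalerA mulrC divfK.
have [e ->] := b_span v.
exists (fun j => e (lift k j) - e k * (c (lift k j) / c k)).
rewrite (bigD1_ord k)//= bkE scalerN scaler_sumr addrC -sumrB.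
by apply: eq_bigr => j _; rewrite scalerBl scalerA.
Qed.

Lemma bounded_linear_functional_continuous (R : realType) (V : normedModType R)
    (phi : {linear V -> R^o}) (d M : R) : 0 < d ->
  (forall v, `|v| < d -> `|(phi v : R)| <= M) -> continuous phi.
Proof.
move=> d0 phiM; apply: bounded_linear_continuous.
apply/ex_bound; exists M; apply/nbhs_norm0P; exists d => //=.
Qed.

(** The norm of [T c] has a positive minimum on the compact unit sphere of coordinate vectors, so
    the norm of a vector controls its coordinates. *)
Lemma findim_functional_continuous (R : realType) (V : normedModType R)
    (phi : {linear V -> R^o}) : finite_dimensional V -> continuous phi.
Proof.
move=> /finite_dimensional_basis[n [b [b_span b_free]]].
pose T (c : 'rV[R]_n) : V := \sum_(i < n) c 0 i *: b i.
have TZ t c : T (t *: c) = t *: T c.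
  by rewrite scaler_sumr; apply: eq_bigr => i _; rewrite mxE scalerA.
have Tsurj v : exists c, v = T c.
  have [c ->] := b_span v; exists (\row_i c i).
  by apply: eq_bigr => i _; rewrite mxE.
have T_cont : continuous T.
  apply: continuous_big => [|i _ c]; first exact: add_continuous.
  exact/continuousZr_tmp/coord_continuous.
pose S := [set c : 'rV[R]_n | `|c| = 1].
have S_compact : compact S.
  apply: bounded_closed_compact.
    exists 1; split=> // x x1 c Sc; apply: le_trans (ltW x1).
    by rewrite le_eqVlt; apply/orP; left; apply/eqP.
  apply: (@preimage_closed _ _ (fun c : 'rV[R]_n => `|c|) [set 1]) => //.
  by move=> c _; exact: norm_continuous.
have normalize (c : 'rV[R]_n) : c <> 0 -> S (`|c|^-1 *: c).
  by move=> /eqP c0; rewrite /S/= normrZ normfV normr_id mulVf// normr_eq0.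
have T0 : T 0 = 0 by rewrite -(scale0r 0) TZ scale0r.
(* An empty sphere means that 0 is the only coordinate vector, so V is the zero space. *)
have [[c1 Sc1]|S0] := pselect (S !=set0); last first.
  apply: (@bounded_linear_functional_continuous _ _ _ 1 0) => // v _.
  have [c ->] := Tsurj v; have [->|/normalize Sc] := pselect (c = 0).
    by rewrite T0 linear0 normr0.
  by exfalso; apply: S0; eexists; exact: Sc.
have [|m Sm m_min] :=
    @EVT_min_rV R n (fun c => `|T c|) S (ex_intro _ _ Sc1) S_compact.
  apply: continuous_subspaceT => c; apply: continuous_comp; first exact: T_cont.
  exact: norm_continuous.
have Tm0 : 0 < `|T m|.
  rewrite normr_gt0; apply/eqP => /b_free m0.
  move: Sm; rewrite inE /S/= (_ : m = 0) ?normr0.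
    by move/esym/eqP; rewrite oner_eq0.
  by apply/rowP => i; rewrite m0 mxE.
have T_ge c : `|T m| * `|c| <= `|T c|.
  have [->|c0] := pselect (c = 0); first by rewrite normr0 mulr0.
  have := m_min _ (mem_set (normalize _ c0)).
  rewrite TZ normrZ normfV normr_id -ler_pdivrMl ?invr_gt0 ?normr_gt0.
    by rewrite invrK mulrC.
  exact/eqP.
(* In the ball of radius [|T m|] all coordinates have absolute value at most 1. *)
apply: (@bounded_linear_functional_continuous _ _ _ `|T m|
  (\sum_(i < n) `|(phi (b i) : R)|)) => // v.
have [c ->] := Tsurj v => Tc.
have c1_lt : `|c| < 1.
  by have := le_lt_trans (T_ge c) Tc; rewrite gtr_pMr.
rewrite linear_sum; apply: le_trans (ler_norm_sum _ _ _) _.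
apply: ler_sum => i _; rewrite linearZ normrM ler_piMl//.
apply: le_trans (ltW c1_lt).
rewrite [leRHS]/Num.norm/= mx_normrE.
by apply/bigmax_geP; right; exists (0, i).
Qed.

(** * Interiors of convex cones and nonnegative functionals *)

Lemma nbhs_addP (R : realType) (V : normedModType R) (A : set V) (x : V) :
  nbhs x A <-> exists2 e : R, 0 < e & forall v, `|v| < e -> A (x + v).
Proof.
split=> [/nbhs_normP[e /= e0 xe]|[e e0 xe]].
  by exists e => // v ve; apply: xe; rewrite /= opprD addNKr normrN.
apply/nbhs_normP; exists e => //= y; rewrite /= distrC => /xe.
by rewrite addrC subrK.
Qed.

Lemma differentiable_remainder (R : realType) (V W : normedModType R)
    (f : V -> W) (x : V) (e : R) : differentiable f x -> 0 < e ->
  exists2 d : R, 0 < d &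
    forall h, `|h| < d -> `|f (x + h) - (f x + 'd f x h)| <= e * `|h|.
Proof.
move=> /diff_locally /eqaddoP fx e0.
have /nbhs_norm0P[d /= d0 fxd] := fx e e0.
by exists d => // h hd; rewrite [x + h]addrC; exact: fxd.
Qed.

(** The sum is twice the midpoint. *)
Lemma convex_set_add (R : realType) (V : lmodType R) (A : set V) x y :
  convex_set A -> (forall t z, 0 < t -> A z -> A (t *: z)) ->
  A x -> A y -> A (x + y).
Proof.
move=> cA Ascale Ax Ay.
have h01 : 0 <= (2^-1 : R) <= 1 by lra.
have [h0 h1] := andP h01.
have := cA x y (Itv01 h0 h1) (mem_set Ax) (mem_set Ay).
rewrite inE /conv/= => Ahalf.
have /Ascale/(_ Ahalf) : (0 : R) < 2 by lra.
have -> : unstable.onem (2^-1 : R) = 2^-1 by rewrite /unstable.onem; field.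
by rewrite -scalerDr scalerA divff ?scale1r.
Qed.

Lemma cone_scale (R : realType) (V : lmodType R) (C : set V) t x :
  0 <= t -> cone C x -> cone C (t *: x).
Proof.
move=> t0 [s [c [s0 Cc ->]]]; exists (t * s), c.
by rewrite scalerA mulr_ge0.
Qed.

Section convex_cones.
Variables (R : realType) (V : normedModType R) (K : set V).
Hypothesis K_cone : convex_cone K.

Lemma convex_cone_scale t x : 0 <= t -> K x -> K (t *: x).
Proof. by move=> t0 Kx; apply: (proj1 K_cone); exists t, x. Qed.

Lemma convex_cone_add x y : K x -> K y -> K (x + y).
Proof.
apply: convex_set_add (proj2 K_cone) _ => t z /ltW; exact: convex_cone_scale.
Qed.

Lemma interior_cone_add x y : interior K x -> K y -> interior K (x + y).
Proof.
move=> /nbhs_addP[e e0 Ke] Ky; apply/nbhs_addP; exists e => // v ve.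
by rewrite addrAC; apply: convex_cone_add => //; exact: Ke.
Qed.

Lemma interior_cone_scale t x : 0 < t -> interior K x -> interior K (t *: x).
Proof.
move=> t0 /nbhs_addP[e e0 Ke]; apply/nbhs_addP.
exists (t * e); first exact: mulr_gt0.
move=> v ve; have := convex_cone_scale (ltW t0) (Ke (t^-1 *: v) _).
rewrite scalerDr scalerA divff ?gt_eqF// scale1r; apply.
by rewrite normrZ gtr0_norm ?invr_gt0// ltr_pdivrMl.
Qed.

Lemma interior_core b : interior K b -> core_point K b.
Proof.
move=> /nbhs_addP[e e0 Ke] v.
have v0 : 0 < `|v| + 1 by rewrite ltr_wpDl.
exists (e / (`|v| + 1)); first exact: divr_gt0.
apply: Ke; rewrite normrZ gtr0_norm ?divr_gt0// -mulrA gtr_pMr//.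
by rewrite mulrC ltr_pdivrMr// mul1r ltrDl.
Qed.

End convex_cones.

Section nonnegative_functionals.
Variables (R : realType) (V : normedModType R) (B : set V).
Variable phi : {linear V -> R^o}.
Hypothesis phi_ge0 : forall v, B v -> 0 <= (phi v : R).

(** If b + v and b - v both lie in B, then [|phi v|] is at most [phi b]. *)
Lemma nonneg_functional_continuous b : interior B b -> continuous phi.
Proof.
move=> /nbhs_addP[e e0 Be].
apply: (@bounded_linear_functional_continuous _ _ _ e (phi b)) => // v ve.
have pos : 0 <= (phi b + phi v : R) by rewrite -linearD; exact/phi_ge0/Be.
have neg : 0 <= (phi b - phi v : R).
  by rewrite -linearB; apply/phi_ge0/Be; rewrite normrN.
by rewrite ler_norml -subr_ge0 opprK addrC pos -subr_ge0.
Qed.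

(** With [phi b] nonpositive, nonnegativity at b + e v forces [phi v] to be nonnegative for every v,
    hence also for - v. *)
Lemma nonneg_functional_eq0 b : core_point B b -> (phi b : R) <= 0 ->
  forall v, phi v = 0.
Proof.
move=> b_core phib.
have ge0 v : 0 <= (phi v : R).
  have [e e0 /phi_ge0] := b_core v; rewrite linearD linearZ => /= phiv.
  by rewrite -(pmulr_rge0 _ e0); apply: le_trans phiv _; rewrite gerDr.
move=> v; apply/eqP; rewrite eq_le ge0 andbT.
by have := ge0 (- v); rewrite linearN oppr_ge0.
Qed.

End nonnegative_functionals.

Lemma cone_separation_interior (R : realType) (V : normedModType R)
    (B : set V) : blunt_cone B -> interior B !=set0 ->
  exists phi : {linear V -> R^o}, [/\ continuous phi, exists b, phi b = 1 &
    forall v, B v -> 0 <= (phi v : R)].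
Proof.
move=> B_blunt [b Bb].
have [phi phi1 phi_ge0] := cone_separation_core B_blunt (interior_subset Bb)
  (interior_core Bb).
exists phi; split=> //; last by exists b.
exact: nonneg_functional_continuous phi_ge0 _ Bb.
Qed.

(** * Directional metric subregularity and exclusion of descent directions *)

Lemma minimal_time_lt (R : realType) (V : normedModType R) (L : set V) (x : V)
    (A : set V) (r : R) : (minimal_time L x A < r%:E)%E ->
  exists t u, [/\ 0 <= t, t < r, L u & A (x + t *: u)].
Proof.
move=> /ereal_inf_lt[_ [t [t0 [u Lu Atu]] <-]]; rewrite lte_fin => tr.
by exists t, u.
Qed.

Lemma minimal_time_le (R : realType) (V : normedModType R) (L : set V) (x u : V)
    (A : set V) (t : R) : 0 <= t -> L u -> A (x + t *: u) ->
  (minimal_time L x A <= t%:E)%E.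
Proof.
move=> t0 Lu Atu; apply: ereal_inf_lbound.
by exists t => //; split=> //; exists u.
Qed.

(** Subregularity as an actual step: z in F x bounds the distance from 0 by the norm of z. The
    strict bound by r is there because the infimum may not be attained. *)
Lemma subregular_approach (R : realType) (X Z : normedModType R)
    (F : X -> set Z) (xbar : X) (L : set X) : L !=set0 ->
  dir_metric_subregular F xbar 0 L (unit_sphere Z) ->
  exists2 a : R, 0 < a & exists2 d : R, 0 < d & forall h z r,
    `|h| < d -> `|z| < d -> F (xbar + h) z -> a * `|z| < r ->
    exists s l, [/\ 0 <= s, s < r, L l & F (xbar + h + s *: l) 0].
Proof.
move=> [l0 Ll0] [a [U [N [a0 /nbhs_addP[d1 d10 Ud1] + reg]]]].
move=> /nbhs_addP[d2 d20 Nd2].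
exists a => //; exists (Num.min d1 d2); first by rewrite lt_min d10.
move=> h z r; rewrite !lt_min => /andP[hd _] /andP[_ zd] Fz zr.
(* For z = 0 there is no unit vector along z, but the point is already a solution and a step of
   length 0 suffices. *)
have [z0|z0] := eqVneq z 0.
  rewrite z0 in Fz; rewrite z0 normr0 mulr0 in zr.
  by exists 0, l0; rewrite scale0r addr0.
apply: (@minimal_time_lt _ _ _ _ (set_valued_inv F 0)).
apply: le_lt_trans (reg _ (Ud1 _ hd)) _.
apply: (@le_lt_trans _ _ (a%:E * `|z|%:E)%E); last by rewrite -EFinM lte_fin.
apply: lee_wpmul2l; first by rewrite lee_fin ltW.
apply: (@minimal_time_le _ _ _ _ (`|z|^-1 *: z)) => //.
  by rewrite /unit_sphere/= normrZ normfV normr_id mulVf ?normr_eq0.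
rewrite scalerA divff ?normr_eq0// scale1r add0r; split=> //.
by rewrite -[z]add0r; exact: Nd2.
Qed.

Lemma no_descent_direction (R : realType) (X Y Z : normedModType R)
    (K : set Y) (Q : set Z) (L : set X) (f : X -> Y) (g : X -> Z) (xbar u : X) :
  convex_cone K -> convex_cone Q ->
  L `<=` unit_sphere X -> L !=set0 -> convex_set (cone L) ->
  differentiable f xbar -> differentiable g xbar ->
  local_weak_dir_pareto_min f K (set_valued_inv (epi_map g Q) 0) L xbar ->
  dir_metric_subregular (epi_map g Q) xbar 0 L (unit_sphere Z) ->
  cone L u -> interior K (- 'd f xbar u) -> ~ Q (- 'd g xbar u).
Proof.
move=> K_cone Q_cone L_sphere L0 coneL_convex df dg [[q0 Qq0 gq0]].
move=> [U /nbhs_addP[dU dU0 UdU] xbar_min] subreg Lu Ku Qu.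
have [a a0 [d1 d10 reach]] := subregular_approach L0 subreg.
have /nbhs_interior/nbhs_addP[r r0 Kr] := Ku.
have u0 : 0 <= `|u| by [].
have u1 : 0 < `|u| + 1 by lra.
have u2 : 0 < `|u| + 2 by lra.
have [M M0 dfM] : exists2 M : R, 0 < M & forall v, `|'d f xbar v| <= M * `|v|.
  have /linear_bounded_continuous/linear_boundedP/pinfty_ex_gt0[M M0 HM] :=
    diff_continuous df.
  by exists M.
(* Bound for s / t, where s is the length of the corrective step: at most 1, and small enough that
   its effect through the derivative of f is at most t r / 2. *)
pose eta := Num.min 1 (r / (2 * M)).
have eta0 : 0 < eta by rewrite lt_min ltr01 divr_gt0// mulr_gt0.
have eta1 : eta <= 1 by rewrite ge_min lexx.
have etaM : M * eta <= r / 2.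
  have : eta * (2 * M) <= r.
    by rewrite -ler_pdivlMr ?mulr_gt0// ge_min lexx orbT.
  by lra.
(* Accuracies for the expansions of g and f: e1 makes the corrective step shorter than t eta, e2
   keeps the remainder of f below t r / 2. *)
have [e1 e10 e1E] : exists2 e1 : R, 0 < e1 & a * (e1 * (`|u| + 1)) = eta.
  exists (eta / (a * (`|u| + 1))); first by rewrite divr_gt0// mulr_gt0.
  by field; rewrite !gt_eqF.
have [e2 e20 e2E] : exists2 e2 : R, 0 < e2 & e2 * (2 * (`|u| + 2)) = r.
  exists (r / (2 * (`|u| + 2))); first by rewrite divr_gt0// mulr_gt0.
  by field; rewrite gt_eqF.
have [dg1 dg10 g_rem] := differentiable_remainder dg e10.
have [df1 df10 f_rem] := differentiable_remainder df e20.
pose m := Num.min (Num.min dU d1) (Num.min dg1 df1).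
have m0 : 0 < m by rewrite !lt_min dU0 d10 dg10 df10.
have mlt x : x < m -> [/\ x < dU, x < d1, x < dg1 & x < df1].
  by rewrite !lt_min => /andP[/andP[-> ->] /andP[-> ->]].
(* The first bound keeps t u and the corrected displacement, both of norm at most t ([|u|] + 1),
   within all radii; the second keeps the remainder of g below d1. *)
pose t := Num.min (m / (2 * (`|u| + 1))) (d1 / (2 * e1 * (`|u| + 1))).
have t0 : 0 < t by rewrite lt_min !divr_gt0// !mulr_gt0.
have t_m : t * (`|u| + 1) < m.
  have : t <= m / (2 * (`|u| + 1)) by rewrite ge_min lexx.
  rewrite ler_pdivlMr ?mulr_gt0// => t_le; have := mulr_gt0 t0 u1.
  by lra.
have t_d : e1 * (t * (`|u| + 1)) < d1.
  have : t <= d1 / (2 * e1 * (`|u| + 1)) by rewrite ge_min lexx orbT.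
  rewrite ler_pdivlMr ?mulr_gt0 ?mulr_gt0// => t_le.
  by have := mulr_gt0 e10 (mulr_gt0 t0 u1); lra.
have tu : `|t *: u| < t * (`|u| + 1).
  by rewrite normrZ gtr0_norm// ltr_pM2l// ltrDl.
have [tuU tud1 tug tuf] := mlt _ (lt_trans tu t_m).
pose z := g (xbar + t *: u) - (g xbar + 'd g xbar (t *: u)).
have z_le : `|z| <= e1 * `|t *: u| by exact: g_rem.
have z_d : `|z| < d1.
  apply: le_lt_trans z_le _; apply: lt_trans t_d.
  by rewrite ltr_pM2l.
(* The remainder z is a value of the set-valued map, because - g xbar and - t g'(xbar) u both lie in
   Q. *)
have Fz : epi_map g Q (xbar + t *: u) z.
  exists (q0 + t *: - 'd g xbar u).
    by apply: convex_cone_add => //; exact: convex_cone_scale (ltW t0) Qu.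
  rewrite /z linearZ/= opprD scalerN; congr (_ + (_ - _)).
  by move/eqP: gq0; rewrite addrC addr_eq0 => /eqP.
have zr : a * `|z| < t * eta.
  apply: (@le_lt_trans _ _ (a * (e1 * `|t *: u|))); first by rewrite ler_pM2l.
  apply: (@lt_le_trans _ _ (a * (e1 * (t * (`|u| + 1))))).
    by rewrite !ltr_pM2l.
  by rewrite -e1E; lra.
have [s [l [s0 st Ll Fl]]] := reach _ _ _ tud1 z_d Fz zr.
have l1 : `|l| = 1 by exact: L_sphere.
pose h := t *: u + s *: l.
have s_lt : s < t by apply: lt_le_trans st _; rewrite ger_pMr.
have h_le : `|h| <= t * (`|u| + 1).
  apply: le_trans (ler_normD _ _) _.
  rewrite !normrZ l1 mulr1 gtr0_norm// (ger0_norm s0) mulrDr mulr1.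
  by rewrite lerD2l ltW.
have [hU _ _ hf] := mlt _ (le_lt_trans h_le t_m).
(* Convexity of [cone L] makes the corrected displacement admissible. *)
have Lh : cone L h.
  apply: convex_set_add coneL_convex _ _ _.
  - by move=> t' v /ltW; exact: cone_scale.
  - exact: cone_scale (ltW t0) Lu.
  - by exists s, l.
apply: (xbar_min (xbar + h)).
  split; last by exists h.
  by split; [exact: UdU|rewrite /set_valued_inv/= /h addrA].
exists (- (f (xbar + h) - f xbar)); last by rewrite opprK.
have f_h := f_rem h hf.
(* w gathers the remainder of f and the effect of s l. After division by t it has norm below r, so
   it does not leave the ball around - f'(xbar) u inside [interior K]. *)
pose w := f (xbar + h) - (f xbar + 'd f xbar h) + s *: 'd f xbar l.
have -> : - (f (xbar + h) - f xbar) = t *: (- 'd f xbar u + - (t^-1 *: w)).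
  rewrite -opprD scalerN scalerDr scalerA divff ?gt_eqF// scale1r; congr (- _).
  have split_rem (y1 y0 D A B : Y) : D = A + B ->
      y1 - y0 = A + (y1 - (y0 + D) + B).
    move=> ->; rewrite [y0 + _]addrA opprD [in RHS](addrA y1) subrK [RHS]addrC.
    by rewrite opprD addrA subrK.
  by apply: split_rem; rewrite (linearD ('d f xbar)) !linearZ.
apply: interior_cone_scale => //; apply: Kr.
rewrite normrN normrZ gtr0_norm ?invr_gt0// ltr_pdivrMl//.
have w_le : `|w| <= e2 * `|h| + s * M.
  apply: le_trans (ler_normD _ _) _; apply: lerD; first exact: f_h.
  rewrite normrZ ger0_norm// ler_wpM2l//.
  by have := dfM l; rewrite l1 mulr1.
apply: le_lt_trans w_le _.
have h1 : e2 * `|h| <= e2 * (t * (`|u| + 1)) by rewrite ler_pM2l.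
have h2 : s * M < t * eta * M by rewrite ltr_pM2r.
have h3 : t * (M * eta) <= t * (r / 2) by rewrite ler_pM2l.
have h4 := mulr_gt0 t0 e20.
have h5 : t * (e2 * (2 * (`|u| + 2))) = t * r by rewrite e2E.
by lra.
Qed.

(** * Multipliers *)

Section multipliers.
Variables (R : realType) (X Y Z : normedModType R).
Variables (K : set Y) (Q : set Z) (P : set X).
Variables (F : {linear X -> Y}) (G : {linear X -> Z}).

(** Taking k in [interior K] keeps 0 out, which u = k = q = 0 would otherwise produce. *)
Definition extended_image : set (Y * Z)%type :=
  [set w | exists u k q,
    [/\ P u, interior K k, Q q & w = (F u + k, G u + q)]].

Hypotheses (K_cone : convex_cone K) (Q_cone : convex_cone Q).
Hypotheses (Q0 : Q 0) (P0 : P 0).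
Hypothesis P_add : forall u v, P u -> P v -> P (u + v).
Hypothesis P_scale : forall t u, 0 < t -> P u -> P (t *: u).
Hypothesis no_descent : forall u, P u -> interior K (- F u) -> ~ Q (- G u).

Lemma extended_image_blunt : blunt_cone extended_image.
Proof.
split.
- move=> _ _ [u [k [q [Pu Kk Qq ->]]]] [v [k' [q' [Pv Kk' Qq' ->]]]].
  exists (u + v), (k + k'), (q + q'); split.
  + exact: P_add.
  + by apply: interior_cone_add => //; exact: interior_subset.
  + exact: convex_cone_add.
  + by congr pair; rewrite /= linearD addrACA.
- move=> t _ t0 [u [k [q [Pu Kk Qq ->]]]].
  exists (t *: u), (t *: k), (t *: q); split.
  + exact: P_scale.
  + exact: interior_cone_scale.
  + by apply: convex_cone_scale => //; exact: ltW.
  + by congr pair; rewrite /= linearZ scalerDr.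
- move=> [u [k [q [Pu Kk Qq [/esym/eqP + /esym/eqP]]]]].
  rewrite !addr_eq0 => /eqP Fu /eqP Gu.
  by apply: (no_descent Pu); rewrite ?Fu ?Gu opprK.
Qed.

Lemma extended_image_neq0 : interior K !=set0 -> extended_image !=set0.
Proof. by move=> [k Kk]; exists (F 0 + k, G 0 + 0), 0, k, 0. Qed.

(** If Q has interior, u = 0 already gives the product of [interior K] and Q; otherwise the image of
    P is translated by (k0, 0). *)
Lemma extended_image_interior : interior K !=set0 ->
  interior Q !=set0 \/ interior [set (F u, G u) | u in P] !=set0 ->
  interior extended_image !=set0.
Proof.
move=> [k0 Kk0] [[q0 Qq0]|[w Dw]].
  exists (k0, q0).
  have Kk0' : nbhs k0 (interior K) by exact/nbhs_interior.
  exists (interior K, Q) => //= -[k q] /= [Kk Qq].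
  exists 0, k, q; split=> //.
  by congr pair; rewrite /= linear0 add0r.
move: Dw => /nbhs_addP[e e0 De].
exists (w + (k0, 0)); apply/nbhs_addP; exists e => // v ve.
have [u Pu uE] := De v ve; exists u, k0, 0; split=> //.
by rewrite addrAC -uE.
Qed.

Lemma cone_multipliers : interior K !=set0 ->
  (interior Q !=set0 \/ interior [set (F u, G u) | u in P] !=set0) \/
    (finite_dimensional Y /\ finite_dimensional Z) ->
  exists (ystar : {linear Y -> R^o}) (zstar : {linear Z -> R^o}),
    [/\ continuous ystar, continuous zstar,
      ~ ((forall y, ystar y = 0) /\ (forall z, zstar z = 0)) &
      forall u k q, P u -> K k -> Q q ->
        0 <= (ystar (F u + k) + zstar (G u + q) : R)].
Proof.
move=> K0 cond.
(* In the finite-dimensional case continuity is left open here and obtained later, separately on Y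
   and Z. *)
have [phi [phi_cont [b phib] phi_ge0]] :
  exists phi : {linear (Y * Z)%type -> R^o},
    [/\ continuous phi \/ (finite_dimensional Y /\ finite_dimensional Z),
      exists b, phi b = 1 & forall v, extended_image v -> 0 <= (phi v : R)].
  case: cond => [int|[Yfin Zfin]].
    have [phi [phi_cont phi1 phi_ge0]] := cone_separation_interior
      extended_image_blunt (extended_image_interior K0 int).
    by exists phi; split=> //; left.
  have [phi [phi1 phi_ge0]] := cone_separation_findim
    (finite_dimensional_prod Yfin Zfin) extended_image_blunt
    (extended_image_neq0 K0).
  by exists phi; split=> //; right.
(* The multipliers are the restrictions of phi to the two factors. *)
have [ystar ystarE] : exists ystar : {linear Y -> R^o},
    forall y, ystar y = phi (y, 0).
  apply: linear_of_fun => t y y'; rewrite -linearP; congr (phi _).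
  by congr pair; rewrite /= scaler0 addr0.
have [zstar zstarE] : exists zstar : {linear Z -> R^o},
    forall z, zstar z = phi (0, z).
  apply: linear_of_fun => t z z'; rewrite -linearP; congr (phi _).
  by congr pair; rewrite /= scaler0 addr0.
have phiE y z : phi (y, z) = ystar y + zstar z.
  rewrite ystarE zstarE -linearD; congr (phi _).
  by congr pair; rewrite /= ?addr0 ?add0r.
exists ystar, zstar; split.
- case: phi_cont => [phi_cont|[Yfin _]]; last first.
    exact: findim_functional_continuous.
  rewrite (_ : GRing.Linear.sort ystar = fun y => phi (y, 0)) ?funeqE// => y.
  apply: continuous_comp; last exact: phi_cont.
  by apply: cvg_pair; [exact: cvg_id|exact: cvg_cst].
- case: phi_cont => [phi_cont|[_ Zfin]]; last first.
    exact: findim_functional_continuous.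
  rewrite (_ : GRing.Linear.sort zstar = fun z => phi (0, z)) ?funeqE// => z.
  apply: continuous_comp; last exact: phi_cont.
  by apply: cvg_pair; [exact: cvg_cst|exact: cvg_id].
- move=> [y0 z0]; move: phib; case: b => y z; rewrite phiE y0 z0 addr0.
  by move/esym/eqP; rewrite oner_eq0.
- move=> u k q Pu Kk Qq; have [k0 Kk0] := K0.
  (* k + t k0 is interior to K for every t > 0. *)
  apply: (@ge0_of_perturbation _ _ (ystar k0)) => t t0.
  have : extended_image (F u + k + t *: k0, G u + q).
    exists u, (t *: k0 + k), q; split=> //; last by rewrite -addrA [k + _]addrC.
    by apply: interior_cone_add => //; exact: interior_cone_scale.
  by move=> /phi_ge0; rewrite phiE (linearD _ (F u + k)) linearZ addrAC.
Qed.

End multipliers.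

Theorem theorem3p9 (R : realType) (X Y Z : normedModType R)
    (K : set Y) (Q : set Z) (L : set X) (f : X -> Y) (g : X -> Z) (xbar : X)
    (K_cone : convex_cone K) (K_proper : proper_cone K)
    (K_int : interior K !=set0)
    (Q_closed : closed Q) (Q_cone : convex_cone Q) (Q_pointed : pointed Q)
    (L_sphere : L `<=` unit_sphere X) (L_nonempty : L !=set0)
    (L_closed : closed L)
    (f_C1 : continuously_differentiable f)
    (g_C1 : continuously_differentiable g)
    (xbar_min : local_weak_dir_pareto_min f K
                  (set_valued_inv (epi_map g Q) 0) L xbar)
    (coneL_convex : convex_set (cone L))
    (subreg : dir_metric_subregular (epi_map g Q) xbar 0 L (unit_sphere Z))
    (cond :
      (interior Q !=set0 \/
       interior [set ('d f xbar u, 'd g xbar u) | u in cone L] !=set0) \/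
      (finite_dimensional Y /\ finite_dimensional Z)) :
  exists (ystar : {linear Y -> R^o}) (zstar : {linear Z -> R^o}),
    [/\ dual_cone K ystar, dual_cone Q zstar,
        ~ ((forall y, ystar y = 0) /\ (forall z, zstar z = 0)),
        forall u, cone L u -> 0 <= ystar ('d f xbar u) + zstar ('d g xbar u) &
        (interior Q !=set0 /\
           (exists2 u, cone L u & set_opp (interior Q) ('d g xbar u))) \/
        'd g xbar @` cone L = setT ->
        ~ (forall y, ystar y = 0)].
Proof.
have [df _] := f_C1; have [dg _] := g_C1.
have Q0 : Q 0.
  have : (Q `&` set_opp Q) 0 by rewrite Q_pointed.
  by case.
have K0 : K 0.
  have [k /interior_subset Kk] := K_int.
  by have := convex_cone_scale K_cone (lexx 0) Kk; rewrite scale0r.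
have L0 : cone L 0 by have [l Ll] := L_nonempty; exists 0, l; rewrite scale0r.
have L_scale t u : 0 < t -> cone L u -> cone L (t *: u).
  by move=> /ltW; exact: cone_scale.
have [|ystar [zstar [ystar_cont zstar_cont yz_neq0 yz_ge0]]] :=
    @cone_multipliers R X Y Z K Q (cone L) ('d f xbar) ('d g xbar)
      K_cone Q_cone Q0 L0
      (fun u v => convex_set_add coneL_convex L_scale) L_scale _ K_int cond.
  move=> u; exact: no_descent_direction.
(* Setting two of u, k, q to 0 in turn isolates the stationarity inequality and the two dual cone
   conditions. *)
have descent u : cone L u ->
    0 <= (ystar ('d f xbar u) + zstar ('d g xbar u) : R).
  by move=> Lu; have := yz_ge0 u 0 0 Lu K0 Q0; rewrite !addr0.
have z_ge0 q : Q q -> 0 <= (zstar q : R).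
  move=> Qq; have := yz_ge0 0 0 q L0 K0 Qq.
  by rewrite !linear0 !add0r linear0 add0r.
exists ystar, zstar; split => //.
- split=> // k Kk.
  by have := yz_ge0 0 k 0 L0 Kk Q0; rewrite !linear0 add0r addr0 linear0 addr0.
(* If [ystar] vanishes, [zstar] is nonnegative on the image of [cone L]. It is then nonpositive at
   an interior point of Q, or nonnegative on all of Z; either way it vanishes too. *)
- move=> regular y0; apply: yz_neq0; split=> //.
  have zg_ge0 u : cone L u -> 0 <= (zstar ('d g xbar u) : R).
    by move=> /descent; rewrite y0 add0r.
  case: regular => [[_ [u Lu [q Qq qE]]]|g_onto].
    apply: (nonneg_functional_eq0 z_ge0 (interior_core Qq)).
    by have := zg_ge0 u Lu; rewrite -qE linearN oppr_ge0.
  move=> z; apply/eqP; rewrite eq_le.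
  have ge0 z' : 0 <= (zstar z' : R).
    have [u Lu <-] : ('d g xbar @` cone L) z' by rewrite g_onto.
    exact: zg_ge0.
  by rewrite ge0 andbT -oppr_ge0 -linearN.
Qed.
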